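(* Consider the worst-case cost in the robust optimal control problem (robust OCP) of the context: $$J_{T,w}^*=\min_{\pi_{0:T-1}}\ \max_{\substack{(\Delta_A,\Delta_B)\in\mathcal{P}\\ w_t\in\mathcal{W},\,0\le t\le T-1}}\left\|\begin{bmatrix}\mathbf{Q}^{1/2}&\\&\mathbf{R}^{1/2}\end{bmatrix}\begin{bmatrix}\mathbf{x}\\ \mathbf{u}\end{bmatrix}\right\|_\infty,$$ where the minimum is over the policies $\pi_{0:T-1}$ feasible for the robust OCP. Let $\tilde J_{T,w}^*$ be the optimal cost of the optimization problem (P) of the context with the objective $$\tilde J_T(\widetilde{\mathbf{\Phi}}_x,\widetilde{\mathbf{\Phi}}_u)=\left\|\begin{bmatrix}\mathbf{Q}^{1/2}&\\&\mathbf{R}^{1/2}\end{bmatrix}\begin{bmatrix}\widetilde{\mathbf{\Phi}}_x(:,0)\\ \widetilde{\mathbf{\Phi}}_u(:,0)\end{bmatrix}x_0\right\|_\infty+\left\|\begin{bmatrix}\mathbf{Q}^{1/2}&\\&\mathbf{R}^{1/2}\end{bmatrix}\begin{bmatrix}\widetilde{\mathbf{\Phi}}_x(:,1:T)\\ \widetilde{\mathbf{\Phi}}_u(:,1:T)\end{bmatrix}\right\|_\infty,$$ the first norm being the vector $\ell_\infty$ norm and the second the $\ell_\infty$-induced matrix norm. Then $\tilde J_{T,w}^*\ge J_{T,w}^*$.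
   Context: **Block matrices.** For a horizon $T\ge 1$, $\mathcal{L}_{TV}^{T,p\times q}$ is the set of block-lower-triangular matrices $\mathbf{R}$ with $(T+1)\times(T+1)$ blocks of size $p\times q$, where the block in block-row $i$ and block-column $j$ ($0\le j\le i\le T$, indexed from $0$) is denoted $R^{i,i-j}$. Thus $R^{t,0}$ are the diagonal blocks and $R^{t,t}$ is the block in row $t$, column $0$. $\mathbf{R}(:,j)$ denotes the $j$-th block column and $\mathbf{R}(:,1:T)$ block columns $1,\dots,T$. Blocks of $\widetilde{\mathbf{\Phi}}_x,\widetilde{\mathbf{\Phi}}_u,\mathbf{\Sigma}$ are written $\tilde\Phi_x^{i,j},\tilde\Phi_u^{i,j},\Sigma^{i,j}$. $Z$ is the block-downshift matrix (identity blocks $I_{n_x}$ on the first block sub-diagonal, zero elsewhere). $\hat{\mathbf{A}}=\mathrm{blkdiag}(\hat A,\dots,\hat A)$, $\hat{\mathbf{B}}=\mathrm{blkdiag}(\hat B,\dots,\hat B)$ with $T+1$ blocks. $\mathbf{Q}=\mathrm{blkdiag}(Q,\dots,Q,Q_T)$, $\mathbf{R}=\mathrm{blkdiag}(R,\dots,R,0)$ with $T+1$ blocks, $Q\succeq0$, $R\succ0$, $Q_T\succeq0$. $e_i$ is the $i$-th standard basis vector of $\mathbb{R}^{n_x}$; $d_{t,i}$ is the $i$-th entry of $d_t$. **Uncertain system.** $x_{t+1}=(\hat A+\Delta_A)x_t+(\hat B+\Delta_B)u_t+w_t$ with $x_t\in\mathbb{R}^{n_x}$, $u_t\in\mathbb{R}^{n_u}$,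 known $(\hat A,\hat B)$, unknown $(\Delta_A,\Delta_B)\in\mathcal{P}:=\mathrm{Conv}\{(\Delta_{A,1},\Delta_{B,1}),\dots,(\Delta_{A,M},\Delta_{B,M})\}$ (the same $(\Delta_A,\Delta_B)$ at all times of the horizon), and $w_t\in\mathcal{W}$, where $\mathcal{W}\subset\mathbb{R}^{n_x}$ is a (nonempty) polytope. With $h_{\mathcal{W}}(c)=\max_{w\in\mathcal{W}}c^\top w$, set $\sigma_{w,i}=\max\{h_{\mathcal{W}}(e_i),h_{\mathcal{W}}(-e_i)\}$. **Constraints.** $\mathcal{X}=\{x: F_xx\le b_x\}$, $\mathcal{U}=\{u:F_uu\le b_u\}$, $\mathcal{X}_T=\{x:F_Tx\le b_T\}$ are compact polytopes containing the origin in their interior. $\mathrm{facet}(\mathcal{X})$ is the set of pairs $(f,b)$ where $f^\top$ is a row of $F_x$ and $b$ the corresponding entry of $b_x$; likewise for $\mathcal{U}$ and $\mathcal{X}_T$. **Robust OCP.** The policies are causal linear time-varying (LTV) state feedback policies $u_t=\pi_t(x_{0:t})=\sum_{i=0}^tK^{t,t-i}x_i$. A policy $\pi_{0:T-1}$ is feasible for the robust OCP if, with given $x_0=x(k)$, $u_t=\pi_t(x_{0:t})$ and the uncertain dynamics, one has $x_t\in\mathcal{X}$, $u_t\in\mathcal{U}$ for $t=0,\dots,T-1$ and $x_T\in\mathcal{X}_T$, for all $(\Delta_A,\Delta_B)\in\mathcal{P}$ and all $w_0,\dots,w_{T-1}\in\mathcal{W}$. In the cost, $\mathbf{x}=[x_0^\top\cdots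 x_T^\top]^\top$ and $\mathbf{u}=[u_0^\top\cdots u_T^\top]^\top$ are the resulting closed-loop state and input trajectories ($u_T$ has zero weight, so its value is irrelevant). **Problem (P).** Minimize $\tilde J_T(\widetilde{\mathbf{\Phi}}_x,\widetilde{\mathbf{\Phi}}_u)$ over $\widetilde{\mathbf{\Phi}}_x\in\mathcal{L}_{TV}^{T,n_x\times n_x}$, $\widetilde{\mathbf{\Phi}}_u\in\mathcal{L}_{TV}^{T,n_u\times n_x}$, and $\mathbf{\Sigma}\in\mathcal{L}_{TV}^{T,n_x\times n_x}$ of the form $\Sigma^{0,0}=I$, $\Sigma^{t,0}=\mathrm{diag}(d_{t-1})$ with $d_{t-1}\in\mathbb{R}^{n_x}$, $d_{t-1}>0$ entrywise ($1\le t\le T$), all blocks strictly below the block diagonal free, subject to (with $x_0=x(k)$): (a) $\begin{bmatrix} I-Z\hat{\mathbf{A}} & -Z\hat{\mathbf{B}}\end{bmatrix}\begin{bmatrix}\widetilde{\mathbf{\Phi}}_x\\ \widetilde{\mathbf{\Phi}}_u\end{bmatrix}=\mathbf{\Sigma}$; (b) for all vertices $(\Delta_A,\Delta_B)\in\{(\Delta_{A,j},\Delta_{B,j}):1\le j\le M\}$, $i=1,\dots,n_x$, $t=0,\dots,T-1$: $$\big|e_i^\top(\Delta_A\tilde\Phi_x^{t,t}+\Delta_B\tilde\Phi_u^{t,t}-\Sigma^{t+1,t+1})x_0\big|+\sigma_{w,i}+\sum_{s=1}^{t}\big\|e_i^\top(\Delta_A\tilde\Phi_x^{t,t-s}+\Delta_B\tilde\Phi_u^{t,t-s}-\Sigma^{t+1,t+1-s})\big\|_1\le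 d_{t,i};$$ (c) $f^\top\tilde\Phi_x^{t,t}x_0+\sum_{s=1}^t\|f^\top\tilde\Phi_x^{t,t-s}\|_1\le b$ for all $(f,b)\in\mathrm{facet}(\mathcal{X})$, $t=0,\dots,T-1$; (d) $f^\top\tilde\Phi_x^{T,T}x_0+\sum_{s=1}^T\|f^\top\tilde\Phi_x^{T,T-s}\|_1\le b$ for all $(f,b)\in\mathrm{facet}(\mathcal{X}_T)$; (e) $f^\top\tilde\Phi_u^{t,t}x_0+\sum_{s=1}^t\|f^\top\tilde\Phi_u^{t,t-s}\|_1\le b$ for all $(f,b)\in\mathrm{facet}(\mathcal{U})$, $t=0,\dots,T-1$. Optimal costs are understood as infima, equal to $+\infty$ for infeasible problems. *)

(* Defs.v *)
From HB Require Import structures.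
From mathcomp Require Import all_boot all_order all_algebra.
From mathcomp Require Import all_classical all_reals all_analysis.
Set Implicit Arguments.
Unset Strict Implicit.
Unset Printing Implicit Defensive.
Import Order.TTheory GRing.Theory Num.Theory.
Import numFieldNormedType.Exports.

Local Open Scope classical_set_scope.
Local Open Scope ring_scope.

(* A vector obtained by stacking x_0, ..., x_T in R^p has stacked_dim T p
   entries; this is the dimension that mxblock, mxcol and mxdiag produce.     *)
Notation stacked_dim T p := (\sum_(i < T.+1) p)%N.

Section Geometry.
Context {R : realType}.

Definition conv_hull (V : lmodType R) (M : nat) (v : 'I_M -> V) : set V :=
  [set x | exists l : 'I_M -> R,
     [/\ forall j, 0 <= l j, \sum_(j < M) l j = 1
       & x = \sum_(j < M) l j *: v j]].

Definition polytope (n : nat) (W : set 'cV[R]_n) : Prop :=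
  exists (N : nat) (v : 'I_N -> 'cV[R]_n), W = conv_hull v.

Definition polyhedron (m n : nat) (F : 'M[R]_(m, n)) (b : 'cV[R]_m) :
    set 'cV[R]_n :=
  [set x | forall i, (F *m x) i 0 <= b i 0].

Definition support_fun (n : nat) (W : set 'cV[R]_n) (c : 'cV[R]_n) : R :=
  sup [set (c^T *m w) 0 0 | w in W].

(* sigma_{w,i}; delta_mx i 0 is the i-th standard basis column vector *)
Definition sigma_w (n : nat) (W : set 'cV[R]_n) (i : 'I_n) : R :=
  Num.max (support_fun W (delta_mx i 0)) (support_fun W (- delta_mx i 0)).

End Geometry.

Section Matrices.
Context {R : realType}.

Definition l1_norm (n : nat) (v : 'rV[R]_n) : R := \sum_(j < n) `|v 0 j|.

(* mx_norm is the largest absolute value of the entries, hence on a column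
   vector the l_infinity norm *)
Definition linf_norm (n : nat) (v : 'cV[R]_n) : R := mx_norm v.

Definition linf_induced_norm (m n : nat) (A : 'M[R]_(m, n)) : R :=
  sup [set linf_norm (A *m v) | v in [set v | linf_norm v <= 1]].

Definition psd (n : nat) (A : 'M[R]_n) : Prop :=
  A^T = A /\ forall v : 'cV[R]_n, 0 <= (v^T *m A *m v) 0 0.

Definition posdef (n : nat) (A : 'M[R]_n) : Prop :=
  A^T = A /\ forall v : 'cV[R]_n, v != 0 -> 0 < (v^T *m A *m v) 0 0.

(* S = A^{1/2}, the unique positive semidefinite square root of A *)
Definition is_psd_sqrt (n : nat) (S A : 'M[R]_n) : Prop :=
  psd S /\ S *m S = A.

End Matrices.

Section Blocks.
Context {R : realType}.
Variable T : nat.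

Definition block_lower (p q : nat)
    (A : 'M[R]_(stacked_dim T p, stacked_dim T q)) : Prop :=
  forall i j : 'I_T.+1, (i < j)%N -> submxblock A i j = 0.

(* A^{i,k}, for k <= i <= T: the second index counts block sub-diagonals, so
   this is the block in block row i and block column i - k. *)
Definition blk (p q : nat) (A : 'M[R]_(stacked_dim T p, stacked_dim T q))
    (i k : nat) : 'M[R]_(p, q) :=
  submxblock A (inord i) (inord (i - k)).

Definition bcol0 (m q : nat) (A : 'M[R]_(m, stacked_dim T q)) : 'M[R]_(m, q) :=
  submxrow A ord0.

Definition bcol1T (m q : nat) (A : 'M[R]_(m, stacked_dim T q)) :
    'M[R]_(m, (\sum_(j < T) q)%N) :=
  \mxrow_(j < T) submxrow A (lift ord0 j).

Definition downshift (n : nat) : 'M[R]_(stacked_dim T n) :=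
  \mxblock_(i < T.+1, j < T.+1)
    (if i == j.+1 :> nat then 1%:M else 0 : 'M[R]_n).

(* blkdiag(A, ..., A); \mxdiag only covers square blocks *)
Definition blkdiag (p q : nat) (A : 'M[R]_(p, q)) :
    'M[R]_(stacked_dim T p, stacked_dim T q) :=
  \mxblock_(i < T.+1, j < T.+1) (if i == j then A else 0).

Definition blkdiag_last (n : nat) (A A_T : 'M[R]_n) : 'M[R]_(stacked_dim T n) :=
  \mxdiag_(i < T.+1) (if i == T :> nat then A_T else A).

End Blocks.

Section RobustOCP.
Context {R : realType} {nx nu : nat}.
Variables (T : nat) (x0 : 'cV[R]_nx).
Variables (Ahat : 'M[R]_nx) (Bhat : 'M[R]_(nx, nu)).
(* Qh and Rh are the square roots of the block diagonal weights *)
Variables (Qh : 'M[R]_(stacked_dim T nx)) (Rh : 'M[R]_(stacked_dim T nu)).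

Section Policies.
Variables (P : set ('M[R]_nx * 'M[R]_(nx, nu))) (W : set 'cV[R]_nx).
Variables (X : set 'cV[R]_nx) (U : set 'cV[R]_nu) (X_T : set 'cV[R]_nx).

(* Only the gains K t s = K^{t,s} with s <= t < T, and only x_0, ..., x_T,
   u_0, ..., u_(T-1) and w_0, ..., w_(T-1) are constrained; u_T is left
   arbitrary, and its weight is zero. *)
Definition closed_loop (K : nat -> nat -> 'M[R]_(nu, nx))
    (D : 'M[R]_nx * 'M[R]_(nx, nu)) (w x : nat -> 'cV[R]_nx)
    (u : nat -> 'cV[R]_nu) : Prop :=
  [/\ x 0%N = x0,
      forall t, (t < T)%N -> u t = \sum_(i < t.+1) K t (t - i)%N *m x i
    & forall t, (t < T)%N ->
        x t.+1 = (Ahat + D.1) *m x t + (Bhat + D.2) *m u t + w t].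

Definition admissible_traj (K : nat -> nat -> 'M[R]_(nu, nx))
    (x : nat -> 'cV[R]_nx) (u : nat -> 'cV[R]_nu) : Prop :=
  exists D w, [/\ P D, forall t, (t < T)%N -> W (w t) & closed_loop K D w x u].

Definition robust_feasible (K : nat -> nat -> 'M[R]_(nu, nx)) : Prop :=
  forall x u, admissible_traj K x u ->
    (forall t, (t < T)%N -> X (x t) /\ U (u t)) /\ X_T (x T).

Definition traj_cost (x : nat -> 'cV[R]_nx) (u : nat -> 'cV[R]_nu) : R :=
  linf_norm (block_mx Qh 0 0 Rh *m
    col_mx (\mxcol_(t < T.+1) x t) (\mxcol_(t < T.+1) u t)).

Definition worst_case_cost (K : nat -> nat -> 'M[R]_(nu, nx)) : \bar R :=
  ereal_sup [set (traj_cost z.1 z.2)%:E |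
    z in [set z | admissible_traj K z.1 z.2]].

Definition robust_ocp_value : \bar R :=
  ereal_inf [set worst_case_cost K | K in [set K | robust_feasible K]].

End Policies.

Section Relaxation.
Variables (M : nat) (DA : 'I_M -> 'M[R]_nx) (DB : 'I_M -> 'M[R]_(nx, nu)).
Variable W : set 'cV[R]_nx.
Variables (mx mu mT : nat).
Variables (Fx : 'M[R]_(mx, nx)) (bx : 'cV[R]_mx).
Variables (Fu : 'M[R]_(mu, nu)) (bu : 'cV[R]_mu).
Variables (FT : 'M[R]_(mT, nx)) (bT : 'cV[R]_mT).

(* e_i^T (Delta_A Phi_x^{t,k} + Delta_B Phi_u^{t,k} - Sigma^{t+1,k+1}) *)
Definition mismatch_row (Phix : 'M[R]_(stacked_dim T nx))
    (Phiu : 'M[R]_(stacked_dim T nu, stacked_dim T nx))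
    (Sigma : 'M[R]_(stacked_dim T nx)) (j : 'I_M) (i : 'I_nx) (t k : nat) :
    'rV[R]_nx :=
  row i (DA j *m blk Phix t k + DB j *m blk Phiu t k - blk Sigma t.+1 k.+1).

(* left-hand side of the tightened constraints: f^T is a row vector, Phi is
   Phi_x or Phi_u *)
Definition tightened (n : nat) (f : 'rV[R]_n)
    (Phi : 'M[R]_(stacked_dim T n, stacked_dim T nx)) (t : nat) : R :=
  (f *m blk Phi t t *m x0) 0 0
  + \sum_(1 <= s < t.+1) l1_norm (f *m blk Phi t (t - s)).

Record sls_feasible (Phix : 'M[R]_(stacked_dim T nx))
    (Phiu : 'M[R]_(stacked_dim T nu, stacked_dim T nx))
    (Sigma : 'M[R]_(stacked_dim T nx)) (d : nat -> 'cV[R]_nx) : Prop := {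
  sls_Phix_lower : block_lower Phix;
  sls_Phiu_lower : block_lower Phiu;
  sls_Sigma_lower : block_lower Sigma;
  sls_Sigma00 : blk Sigma 0 0 = 1%:M;
  sls_Sigma_diag : forall t, (t < T)%N -> blk Sigma t.+1 0 = diag_mx (d t)^T;
  sls_d_gt0 : forall t i, (t < T)%N -> 0 < d t i 0;
  sls_affine :
    row_mx (1%:M - downshift T nx *m blkdiag T Ahat)
           (- (downshift T nx *m blkdiag T Bhat))
      *m col_mx Phix Phiu = Sigma;
  sls_uncertainty : forall j i t, (t < T)%N ->
    `|(mismatch_row Phix Phiu Sigma j i t t *m x0) 0 0| + sigma_w W i
    + \sum_(1 <= s < t.+1) l1_norm (mismatch_row Phix Phiu Sigma j i t (t - s))
    <= d t i 0;
  sls_state : forall k t, (t < T)%N -> tightened (row k Fx) Phix t <= bx k 0;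
  sls_terminal : forall k, tightened (row k FT) Phix T <= bT k 0;
  sls_input : forall k t, (t < T)%N -> tightened (row k Fu) Phiu t <= bu k 0
}.

Definition sls_cost (Phix : 'M[R]_(stacked_dim T nx))
    (Phiu : 'M[R]_(stacked_dim T nu, stacked_dim T nx)) : R :=
  linf_norm (block_mx Qh 0 0 Rh *m col_mx (bcol0 Phix) (bcol0 Phiu) *m x0)
  + linf_induced_norm
      (block_mx Qh 0 0 Rh *m col_mx (bcol1T Phix) (bcol1T Phiu)).

Definition sls_value : \bar R :=
  ereal_inf [set (sls_cost Phi.1 Phi.2)%:E |
    Phi in [set Phi | exists Sigma d, sls_feasible Phi.1 Phi.2 Sigma d]].

End Relaxation.

End RobustOCP.

(* Main.v *)
Require Import Defs.
From HB Require Import structures.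
From mathcomp Require Import all_boot all_order all_algebra.
From mathcomp Require Import all_classical all_reals all_analysis.
Set Implicit Arguments.
Unset Strict Implicit.
Unset Printing Implicit Defensive.
Import Order.TTheory GRing.Theory Num.Theory.
Import numFieldNormedType.Exports.
Local Open Scope classical_set_scope.
Local Open Scope ring_scope.

(* A feasible point of (P) yields the policy u = Phi_u Phi_x^{-1} x.  Along any
   closed-loop trajectory put xi = Phi_x^{-1} x, so that x = Phi_x xi and
   u = Phi_u xi.  Comparing the true with the nominal dynamics, diag(d_t) xi_{t+1}
   is the model mismatch acting on xi_0, ..., xi_t plus w_t; constraint (b),
   extended from the vertices to their convex hull, then gives by induction
   xi_0 = x_0 and |xi_s|_inf <= 1 for s >= 1.  Hoelder's inequality turns (c)-(e)
   into the state and input constraints, and the two terms of the surrogate cost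
   bound the contributions of xi_0 and of xi_1, ..., xi_T. *)

(** * Causal inversion and the realizing policy *)

(** Forward substitution, one block row per induction step. A right inverse suffices: with
    [xi = L x], [P L = I] gives [P xi = x]. *)
Lemma block_lower_inverse (F : fieldType) (n N : nat) (P : nat -> nat -> 'M[F]_n) :
  (forall t, (t < N)%N -> P t t \in unitmx) ->
  exists L : nat -> nat -> 'M[F]_n,
    (forall t i, (t < i)%N -> L t i = 0) /\
    forall t i, (t < N)%N ->
      \sum_(0 <= j < t.+1) P t j *m L j i = if i == t then 1%:M else 0.
Proof.
elim: N => [|N IH] Punit; first by exists (fun _ _ => 0).
have [t ltN|L [L0 LP]] := IH; first by apply: Punit; rewrite ltnS ltnW.
(* The equation of row [N] is solved for its diagonal term; the earlier rows are kept. *)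
pose L' t i := if t == N then
  invmx (P N N) *m ((if i == N then 1%:M else 0) - \sum_(0 <= j < N) P N j *m L j i)
  else L t i.
have L'E (f : nat -> 'M[F]_n) m i : (m <= N)%N ->
    \sum_(0 <= j < m) f j *m L' j i = \sum_(0 <= j < m) f j *m L j i.
  by move=> mN; apply: eq_big_nat => j /andP[_ jm]; rewrite /L' ltn_eqF ?(leq_trans jm).
exists L'; split=> [t i ti|t i].
  rewrite /L'; case: eqP => [tN|_]; last exact: L0.
  rewrite gtn_eqF -?tN // big_nat big1 ?subrr ?mulmx0 // => j /andP[_ jt].
  by rewrite L0 ?mulmx0 // (ltn_trans jt).
rewrite ltnS leq_eqVlt => /orP[/eqP ->|tN]; last by rewrite L'E // LP.
rewrite big_nat_recr //= L'E // /L' eqxx mulKVmx ?Punit //.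
by rewrite addrC subrK.
Qed.

(* u = Phi_u Phi_x^{-1} x and xi = Phi_x^{-1} x. *)
Lemma realizing_gains (F : fieldType) (n m N : nat)
    (Px : nat -> nat -> 'M[F]_n) (Pu : nat -> nat -> 'M[F]_(m, n)) :
  (forall t, (t < N)%N -> Px t t \in unitmx) ->
  exists K : nat -> nat -> 'M[F]_(m, n), forall x : nat -> 'cV[F]_n,
    exists xi : nat -> 'cV[F]_n, forall t, (t < N)%N ->
      x t = \sum_(0 <= j < t.+1) Px t j *m xi j /\
      \sum_(i < t.+1) K t (t - i)%N *m x i = \sum_(0 <= j < t.+1) Pu t j *m xi j.
Proof.
move=> /block_lower_inverse[L [L0 LP]].
(* [K t s] multiplies the state at time [t - s], so it is the block of Phi_u L in column [t - s]. *)
exists (fun t s => \sum_(0 <= j < t.+1) Pu t j *m L j (t - s)%N) => x.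
exists (fun j => \sum_(0 <= i < j.+1) L j i *m x i) => t tN.
(* Associativity of [f (L x)]: the inner sum extends to all [i <= t] because [L] vanishes above the
   diagonal. *)
have xiE p (f : nat -> 'M[F]_(p, n)) :
    \sum_(0 <= j < t.+1) f j *m (\sum_(0 <= i < j.+1) L j i *m x i) =
    \sum_(0 <= i < t.+1) (\sum_(0 <= j < t.+1) f j *m L j i) *m x i.
  under [RHS]eq_bigr do rewrite mulmx_suml.
  rewrite exchange_big_nat /=; apply: eq_big_nat => j /andP[_ jt].
  rewrite (@big_cat_nat _ _ _ j.+1 0 t.+1) //= [X in _ + X]big_nat.
  rewrite [X in _ + X]big1 ?addr0 => [|i /andP[ji _]]; last by rewrite L0 // mulmx0 mul0mx.
  by rewrite mulmx_sumr; apply: eq_bigr => i _; rewrite mulmxA.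
rewrite !xiE; split.
  rewrite big_nat_recr //= big_nat big1 => [|i /andP[_ it]].
    by rewrite LP // eqxx mul1mx add0r.
  by rewrite LP // ltn_eqF // mul0mx.
rewrite [RHS]big_mkord; apply: eq_bigr => i _; congr (_ *m _).
by rewrite subKn // -ltnS.
Qed.

(** * Norms, support functions and square roots *)

Lemma ler_linf_norm (R : realType) (n : nat) (v : 'cV[R]_n) i : `|v i 0| <= linf_norm v.
Proof.
rewrite /linf_norm mx_normrE.
by apply/bigmax_geP; right => /=; exists (i, 0).
Qed.

Lemma linf_norm_ler (R : realType) (n : nat) (v : 'cV[R]_n) (c : R) :
  0 <= c -> (forall i, `|v i 0| <= c) -> linf_norm v <= c.
Proof.
move=> c0 vc; rewrite /linf_norm mx_normrE; apply/bigmax_leP; split=> // -[i j] _ /=.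
by rewrite ord1.
Qed.

Lemma ler_l1_norm (R : realType) (n : nat) (r : 'rV[R]_n) (v : 'cV[R]_n) :
  (forall i, `|v i 0| <= 1) -> `|(r *m v) 0 0| <= l1_norm r.
Proof.
move=> v1; rewrite mxE; apply: le_trans (ler_norm_sum _ _ _) _.
by apply: ler_sum => i _; rewrite normrM ler_piMr.
Qed.

(** The induced norm is a [sup], which dominates its members once they are bounded above; the sum of
    the l1 norms of the rows is a crude bound that is enough. *)
Lemma ler_linf_induced_norm (R : realType) (m n : nat) (A : 'M[R]_(m, n)) (v : 'cV[R]_n) :
  linf_norm v <= 1 -> linf_norm (A *m v) <= linf_induced_norm A.
Proof.
move=> v1; apply: ub_le_sup; last by exists v.
exists (\sum_i l1_norm (row i A)) => _ [z z1 <-].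
have l1_ge0 i : 0 <= l1_norm (row i A) by apply: sumr_ge0.
apply: linf_norm_ler => [|i]; first exact: sumr_ge0.
rewrite (bigD1 i) //= ler_wpDr ?sumr_ge0 //.
have -> : (A *m z) i 0 = (row i A *m z) 0 0 by rewrite -row_mul [RHS]mxE.
by apply: ler_l1_norm => k; apply: le_trans (ler_linf_norm _ _) z1.
Qed.

(** Boundedness is again the point: convex weights are at most 1, so the sum of the [|c^T v_j|] over
    the vertices is an upper bound. *)
Lemma ler_support_fun (R : realType) (n : nat) (W : set 'cV[R]_n) (c w : 'cV[R]_n) :
  polytope W -> W w -> (c^T *m w) 0 0 <= support_fun W c.
Proof.
move=> [N [v ->]] Ww; apply: ub_le_sup; last by exists w.
exists (\sum_j `|(c^T *m v j) 0 0|) => _ [_ [l [l0 l1 ->]] <-].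
rewrite mulmx_sumr summxE; apply: ler_sum => j _.
rewrite -scalemxAr mxE; apply: le_trans (ler_norm _) _.
rewrite normrM ler_piMl // ger0_norm // -l1 (bigD1 j) //= ler_wpDr //.
exact: sumr_ge0.
Qed.

Lemma ler_sigma_w (R : realType) (n : nat) (W : set 'cV[R]_n) (w : 'cV[R]_n) i :
  polytope W -> W w -> `|w i 0| <= sigma_w W i.
Proof.
move=> Wp Ww; have ew : ((delta_mx i 0 : 'cV_n)^T *m w) 0 0 = w i 0.
  by rewrite trmx_delta -rowE mxE.
have New : ((- delta_mx i 0 : 'cV_n)^T *m w) 0 0 = - w i 0.
  by rewrite linearN mulNmx -ew [LHS]mxE.
have := ler_support_fun (delta_mx i 0) Wp Ww.
have := ler_support_fun (- delta_mx i 0) Wp Ww.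
rewrite ew New => Nwi wi.
by rewrite /sigma_w ler_norml lerNl !le_max wi Nwi orbT.
Qed.

(** Since [S] is symmetric, the squared Euclidean norm of [S v] is [v^T A v = 0]. This carries the
    zero weight of u_T over to the square root. *)
Lemma psd_sqrt_ker (R : realType) (n : nat) (S A : 'M[R]_n) (v : 'cV[R]_n) :
  is_psd_sqrt S A -> A *m v = 0 -> S *m v = 0.
Proof.
move=> [[St _] SS] Av.
have /matrixP/(_ 0 0) : (S *m v)^T *m (S *m v) = 0.
  by rewrite trmx_mul St -!mulmxA (mulmxA S) SS Av mulmx0.
rewrite !mxE => /eqP; rewrite psumr_eq0 => [/allP Sv0|i _]; last by rewrite mxE -expr2 sqr_ge0.
apply/colP => i; have := Sv0 i (mem_index_enum i).
by rewrite /= !mxE mulf_eq0 orbb => /eqP.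
Qed.

(** * Block calculus on stacked trajectories *)

(** Indexing by row and column, not by sub-diagonal as in [blk], turns products into plain sums over
    columns. Because of [inord], only indices up to [T] are meaningful. *)
Definition cell (R : Type) (T p q : nat)
    (A : 'M[R]_(stacked_dim T p, stacked_dim T q)) (i j : nat) : 'M[R]_(p, q) :=
  submxblock A (inord i) (inord j).

Lemma blk_cell (R : realType) (T p q : nat)
    (A : 'M[R]_(stacked_dim T p, stacked_dim T q)) t j :
  (j <= t)%N -> blk A t (t - j) = cell A t j.
Proof. by move=> jt; rewrite /blk subKn. Qed.

Lemma cell_eq0 (R : realType) (T p q : nat)
    (A : 'M[R]_(stacked_dim T p, stacked_dim T q)) t j :
  block_lower A -> (t < j <= T)%N -> cell A t j = 0.
Proof.
move=> A_lower /andP[tj jT]; apply: A_lower.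
by rewrite !inordK // ltnS // ltnW // (leq_trans tj).
Qed.

Lemma downshift_blkdiag (R : realType) (T p q : nat) (A : 'M[R]_(p, q)) :
  downshift T p *m blkdiag T A =
  \mxblock_(i < T.+1, j < T.+1) (if i == j.+1 :> nat then A else 0).
Proof.
rewrite /downshift /blkdiag mul_mxblock; apply: eq_mxblock => i j.
rewrite (bigD1 j) //= eqxx big1 ?addr0 => [|k /negPf kj]; last by rewrite kj mulmx0.
by case: ifP => _; rewrite ?mul1mx ?mul0mx.
Qed.

Lemma cell_downshift0 (R : realType) (T p q r : nat) (A : 'M[R]_(p, q))
    (Phi : 'M[R]_(stacked_dim T q, stacked_dim T r)) j :
  cell (downshift T p *m blkdiag T A *m Phi) 0 j = 0.
Proof.
rewrite downshift_blkdiag -[Phi]submxblockK mul_mxblock /cell mxblockK big1 // => k _.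
by rewrite inordK // mul0mx.
Qed.

Lemma cell_downshiftS (R : realType) (T p q r : nat) (A : 'M[R]_(p, q))
    (Phi : 'M[R]_(stacked_dim T q, stacked_dim T r)) t j : (t < T)%N ->
  cell (downshift T p *m blkdiag T A *m Phi) t.+1 j = A *m cell Phi t j.
Proof.
move=> tT; rewrite downshift_blkdiag -{1}[Phi]submxblockK mul_mxblock /cell mxblockK.
rewrite (bigD1 (inord t)) //= !inordK ?eqxx // 1?ltnW // big1 ?addr0 // => k kt.
rewrite eqSS ifN ?mul0mx //; apply: contraNneq kt => ->.
by rewrite inord_val.
Qed.

Lemma stacked_mulmx (R : pzSemiRingType) (T p q : nat)
    (A : 'M[R]_(stacked_dim T p, stacked_dim T q)) (v : nat -> 'cV[R]_q) :
  A *m \mxcol_(j < T.+1) v j =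
  \mxcol_(i < T.+1) \sum_(0 <= j < T.+1) cell A i j *m v j.
Proof.
rewrite -{1}[A]submxblockK mul_mxblock_mxrow; apply: eq_mxcol => i.
by rewrite big_mkord; apply: eq_bigr => j _; rewrite /cell !inord_val.
Qed.

(** Separates the column acting on x_0 from the columns acting on xi_1, ..., xi_T, as the objective
    of (P) does. *)
Lemma stacked_mulmx_bcol (R : realType) (T m q : nat)
    (A : 'M[R]_(m, stacked_dim T q)) (v : nat -> 'cV[R]_q) :
  A *m \mxcol_(j < T.+1) v j =
  bcol0 A *m v 0%N + bcol1T A *m \mxcol_(j < T) v j.+1.
Proof.
rewrite -{1}[A]submxrowK /bcol1T !mul_mxrow_mxcol big_ord_recl.
by congr (_ + _).
Qed.

Lemma block_lower_mulmx (R : realType) (T p q : nat)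
    (A : 'M[R]_(stacked_dim T p, stacked_dim T q)) (v : nat -> 'cV[R]_q) :
  block_lower A ->
  A *m \mxcol_(j < T.+1) v j =
  \mxcol_(i < T.+1) \sum_(0 <= j < i.+1) cell A i j *m v j.
Proof.
move=> A_lower; rewrite stacked_mulmx; apply: eq_mxcol => i.
rewrite (big_cat_nat _ (n := i.+1)) //= [X in _ + X]big_nat.
rewrite [X in _ + X]big1 ?addr0 // => j ijT.
by rewrite cell_eq0 ?mul0mx.
Qed.

(** Constraint (a) read row by row: each block column of (Phi_x, Phi_u) is a nominal trajectory
    driven by the same column of Sigma. The shift leaves row 0 to Sigma alone. *)
Lemma cell_affine (R : realType) (T nx nu : nat)
    (Ahat : 'M[R]_nx) (Bhat : 'M[R]_(nx, nu))
    (Phix Sigma : 'M[R]_(stacked_dim T nx))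
    (Phiu : 'M[R]_(stacked_dim T nu, stacked_dim T nx)) (j : nat) :
  row_mx (1%:M - downshift T nx *m blkdiag T Ahat)
         (- (downshift T nx *m blkdiag T Bhat)) *m col_mx Phix Phiu = Sigma ->
  cell Phix 0 j = cell Sigma 0 j /\
  forall t, (t < T)%N -> cell Phix t.+1 j =
    Ahat *m cell Phix t j + Bhat *m cell Phiu t j + cell Sigma t.+1 j.
Proof.
move=> Sigma_eq; have PhixE : Phix = downshift T nx *m blkdiag T Ahat *m Phix +
    downshift T nx *m blkdiag T Bhat *m Phiu + Sigma.
  rewrite -Sigma_eq mul_row_col mulmxBl mul1mx mulNmx.
  by rewrite [RHS]addrC -[Phix - _ - _]addrA -opprD subrK.
have cellD (A B : 'M[R]_(stacked_dim T nx)) t : cell (A + B) t j = cell A t j + cell B t j.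
  exact: submxblockD.
split=> [|t tT].
  by rewrite {1}PhixE !cellD !cell_downshift0 !add0r.
by rewrite {1}PhixE !cellD !cell_downshiftS.
Qed.

(** * Hoelder bounds behind the tightened constraints *)

(** Hoelder's inequality term by term. The sum starts at 1 because index 0 carries the known x_0. *)
Lemma impulse_tail_le (R : realType) (n t : nat) (r : nat -> 'rV[R]_n) (xi : nat -> 'cV[R]_n) :
  (forall s, (0 < s <= t)%N -> forall i, `|xi s i 0| <= 1) ->
  `|(\sum_(1 <= s < t.+1) r s *m xi s) 0 0| <= \sum_(1 <= s < t.+1) l1_norm (r s).
Proof.
move=> xi1; rewrite summxE; apply: le_trans (ler_norm_sum _ _ _) _.
by apply: ler_sum_nat => s s_t; apply: ler_l1_norm; apply: xi1.
Qed.

(** Column 0 acts exactly on x_0; every later column costs at most its l1 norm. *)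
Lemma tightened_ge (R : realType) (T n nx t : nat) (x0 : 'cV[R]_nx) (f : 'rV[R]_n)
    (Phi : 'M[R]_(stacked_dim T n, stacked_dim T nx)) (xi : nat -> 'cV[R]_nx) :
  xi 0%N = x0 -> (forall s, (0 < s <= t)%N -> forall i, `|xi s i 0| <= 1) ->
  (f *m \sum_(0 <= j < t.+1) cell Phi t j *m xi j) 0 0 <= tightened x0 f Phi t.
Proof.
move=> xi0 xi1; rewrite mulmx_sumr; under eq_bigr do rewrite mulmxA.
rewrite big_ltn // xi0 mxE /tightened.
have -> : blk Phi t t = cell Phi t 0 by rewrite -blk_cell ?subn0.
rewrite lerD2l; apply: le_trans (ler_norm _) _.
apply: le_trans (impulse_tail_le _ xi1) _.
by apply: ler_sum_nat => s /andP[_ st]; rewrite blk_cell.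
Qed.

(** The shifts by 1 in the two indices of Sigma cancel in the column number, so all three blocks lie
    in column [s]. *)
Lemma mismatch_row_cell (R : realType) (T nx nu M : nat)
    (DA : 'I_M -> 'M[R]_nx) (DB : 'I_M -> 'M[R]_(nx, nu))
    (Phix Sigma : 'M[R]_(stacked_dim T nx))
    (Phiu : 'M[R]_(stacked_dim T nu, stacked_dim T nx)) v i t s :
  (s <= t)%N ->
  mismatch_row DA DB Phix Phiu Sigma v i t (t - s) =
  row i (DA v *m cell Phix t s + DB v *m cell Phiu t s - cell Sigma t.+1 s).
Proof. by move=> st; rewrite /mismatch_row -subSn // !blk_cell // ltnW. Qed.

Lemma conv_hull_pair (R : realType) (U V : lmodType R) (M : nat)
    (a : 'I_M -> U) (b : 'I_M -> V) (z : U * V) :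
  conv_hull (fun j => (a j, b j)) z ->
  exists l : 'I_M -> R, [/\ forall j, 0 <= l j, \sum_(j < M) l j = 1,
    z.1 = \sum_(j < M) l j *: a j & z.2 = \sum_(j < M) l j *: b j].
Proof.
move=> [l [l0 l1 ->]]; exists l; split=> //.
  by rewrite (big_morph fst (fun _ _ => erefl) erefl).
by rewrite (big_morph snd (fun _ _ => erefl) erefl).
Qed.

(** * The closed loop of a feasible point of (P) *)

Section Relaxation.
Context {R : realType} {T nx nu M mx mu mT : nat} {x0 : 'cV[R]_nx}.
Context {Ahat : 'M[R]_nx} {Bhat : 'M[R]_(nx, nu)}.
Context {DA : 'I_M -> 'M[R]_nx} {DB : 'I_M -> 'M[R]_(nx, nu)}.
Context {W : set 'cV[R]_nx} (W_polytope : polytope W).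
Context {Fx : 'M[R]_(mx, nx)} {bx : 'cV[R]_mx}.
Context {Fu : 'M[R]_(mu, nu)} {bu : 'cV[R]_mu}.
Context {FT : 'M[R]_(mT, nx)} {bT : 'cV[R]_mT}.
Context {Phix Sigma : 'M[R]_(stacked_dim T nx)}.
Context {Phiu : 'M[R]_(stacked_dim T nu, stacked_dim T nx)} {d : nat -> 'cV[R]_nx}.
Hypothesis feas : sls_feasible x0 Ahat Bhat DA DB W Fx bx Fu bu FT bT Phix Phiu Sigma d.

Let P : set ('M[R]_nx * 'M[R]_(nx, nu)) := conv_hull (fun j : 'I_M => (DA j, DB j)).

(** The mismatch is affine in the uncertainty and the absolute value is convex, so constraint (b)
    passes from the vertices to their convex hull; [sigma_w] absorbs [w]. *)
Lemma perturbation_le (D : 'M[R]_nx * 'M[R]_(nx, nu)) (w : 'cV[R]_nx)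
    (xi : nat -> 'cV[R]_nx) t i :
  (t < T)%N -> P D -> W w -> xi 0%N = x0 ->
  (forall s, (0 < s <= t)%N -> forall k, `|xi s k 0| <= 1) ->
  `|(\sum_(0 <= j < t.+1)
       (D.1 *m cell Phix t j + D.2 *m cell Phiu t j - cell Sigma t.+1 j) *m xi j
     + w) i 0| <= d t i 0.
Proof.
move=> tT /conv_hull_pair[l [l0 l1 D1 D2]] Ww xi0 xi1.
pose E v j := DA v *m cell Phix t j + DB v *m cell Phiu t j - cell Sigma t.+1 j.
have vertex_le v : `|(\sum_(0 <= j < t.+1) E v j *m xi j) i 0| + sigma_w W i <= d t i 0.
  have -> : (\sum_(0 <= j < t.+1) E v j *m xi j) i 0 =
      (\sum_(0 <= j < t.+1) row i (E v j) *m xi j) 0 0.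
    by rewrite !summxE; apply: eq_bigr => j _; rewrite -row_mul [RHS]mxE.
  apply: le_trans (sls_uncertainty feas v i tT).
  rewrite addrAC lerD2r big_ltn // [X in `|X|]mxE xi0.
  have -> : mismatch_row DA DB Phix Phiu Sigma v i t t = row i (E v 0%N).
    by rewrite -mismatch_row_cell ?subn0.
  apply: le_trans (ler_normD _ _) _.
  rewrite lerD2l; apply: le_trans (impulse_tail_le _ xi1) _.
  by apply: ler_sum_nat => s /andP[_ st]; rewrite mismatch_row_cell.
(* The mismatch at [D] is the average of the vertex mismatches; Sigma is unchanged because the
   weights sum to 1. *)
have -> : \sum_(0 <= j < t.+1)
    (D.1 *m cell Phix t j + D.2 *m cell Phiu t j - cell Sigma t.+1 j) *m xi j =
    \sum_v l v *: \sum_(0 <= j < t.+1) E v j *m xi j.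
  under [RHS]eq_bigr do rewrite scaler_sumr.
  rewrite exchange_big; apply: eq_bigr => j _ /=.
  under [RHS]eq_bigr do rewrite scalemxAl.
  rewrite -mulmx_suml; congr (_ *m _).
  under eq_bigr do rewrite !scalerDr scalerN.
  rewrite !big_split /= sumrN -scaler_suml l1 scale1r D1 D2 !mulmx_suml.
  by congr (_ + _ - _); apply: eq_bigr => v _; rewrite scalemxAl.
rewrite [X in `|X|]mxE summxE; apply: le_trans (ler_normD _ _) _.
apply: le_trans (lerD (ler_norm_sum _ _ _) (ler_sigma_w i W_polytope Ww)) _.
(* Both [sigma_w W i] and [d t i 0] become averages with the same weights, so the vertices can be
   compared one by one. *)
rewrite -[leRHS]mul1r -[sigma_w W i]mul1r -l1 !mulr_suml -big_split /=.
apply: ler_sum => v _; rewrite mxE normrM (ger0_norm (l0 v)) -mulrDr.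
by rewrite ler_wpM2l.
Qed.

Lemma cell_Phix00 : cell Phix 0 0 = 1%:M.
Proof. by rewrite (cell_affine _ (sls_affine feas)).1 -(sls_Sigma00 feas). Qed.

(** In column [t.+1] the blocks of row [t] lie above the diagonal and vanish, so the recursion
    leaves only Sigma. *)
Lemma cell_Phix_diag t : (t < T)%N -> cell Phix t.+1 t.+1 = diag_mx (d t)^T.
Proof.
move=> tT; rewrite (cell_affine _ (sls_affine feas)).2 //.
rewrite (cell_eq0 (sls_Phix_lower feas)) ?ltnSn // (cell_eq0 (sls_Phiu_lower feas)) ?ltnSn //.
by rewrite !mulmx0 !add0r -(sls_Sigma_diag feas tT) -(subnn t.+1) blk_cell.
Qed.

(** Positivity of [d] makes Phi_x causally invertible, as the policy requires. *)
Lemma cell_Phix_unit t : (t < T.+1)%N -> cell Phix t t \in unitmx.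
Proof.
case: t => [|t] tT; first by rewrite cell_Phix00 unitmx1.
rewrite cell_Phix_diag // unitmxE det_diag unitfE; apply/prodf_neq0 => i _.
by rewrite mxE gt_eqF ?(sls_d_gt0 feas).
Qed.

Lemma surrogate_disturbance_le1 (D : 'M[R]_nx * 'M[R]_(nx, nu))
    (w x xi : nat -> 'cV[R]_nx) (u : nat -> 'cV[R]_nu) :
  P D -> (forall t, (t < T)%N -> W (w t)) -> x 0%N = x0 ->
  (forall t, (t < T)%N ->
     x t.+1 = (Ahat + D.1) *m x t + (Bhat + D.2) *m u t + w t) ->
  (forall t, (t < T.+1)%N -> x t = \sum_(0 <= j < t.+1) cell Phix t j *m xi j) ->
  (forall t, (t < T)%N -> u t = \sum_(0 <= j < t.+1) cell Phiu t j *m xi j) ->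
  xi 0%N = x0 /\ forall s, (0 < s <= T)%N -> forall i, `|xi s i 0| <= 1.
Proof.
move=> PD Ww x_0 xS xE uE.
have xi0 : xi 0%N = x0 by rewrite -x_0 xE // big_nat1 cell_Phix00 mul1mx.
split=> //; elim/ltn_ind => -[//|t] IH /andP[_ tT] i.
(* The last term of row [t.+1] of Phi_x xi is x_{t+1} minus the earlier terms. The nominal parts of
   the two recursions cancel, leaving mismatch plus noise. *)
have dt : (\sum_(0 <= j < t.+1)
    (D.1 *m cell Phix t j + D.2 *m cell Phiu t j - cell Sigma t.+1 j) *m xi j + w t) =
    diag_mx (d t)^T *m xi t.+1.
  rewrite -cell_Phix_diag //; have := xE _ (tT : (t.+1 < T.+1)%N).
  rewrite big_nat_recr //= => /eqP; rewrite addrC -subr_eq => /eqP <-.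
  rewrite xS // addrAC; congr (_ + _).
  rewrite xE ?uE //; last exact: ltnW.
  rewrite !mulmx_sumr.
  rewrite -big_split -sumrB /=; apply: eq_big_nat => j _.
  rewrite (cell_affine _ (sls_affine feas)).2 // !mulmxA -!mulmxDl -mulmxBl.
  by congr (_ *m _); rewrite !mulmxDl addrACA opprD [RHS]addrACA subrr add0r.
have d0 := sls_d_gt0 feas i tT.
have := perturbation_le i tT PD (Ww t tT) xi0.
(* Entry [i] is [d t i 0] times that of [xi t.+1], so the positive factor cancels and leaves the
   bound 1. *)
rewrite dt mul_diag_mx !mxE normrM gtr0_norm // -[leRHS]mulr1 ler_pM2l //; apply.
by move=> s /andP[s0 st] k; apply: IH => //; rewrite s0 (leq_trans st) // ltnW.
Qed.

End Relaxation.

(** * Comparison of the costs and of the optimal values *)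

(** Triangle inequality between the x_0 column and the rest; the stacked xi_1, ..., xi_T lie in the
    unit ball, where the induced norm applies. *)
Lemma traj_cost_le_sls_cost (R : realType) (T nx nu : nat)
    (Qh : 'M[R]_(stacked_dim T nx)) (Ru : 'M[R]_nu) (Rh : 'M[R]_(stacked_dim T nu))
    (Phix : 'M[R]_(stacked_dim T nx)) (Phiu : 'M[R]_(stacked_dim T nu, stacked_dim T nx))
    (x0 : 'cV[R]_nx) (x xi : nat -> 'cV[R]_nx) (u : nat -> 'cV[R]_nu) :
  is_psd_sqrt Rh (blkdiag_last T Ru 0) -> block_lower Phix -> block_lower Phiu ->
  (forall t, (t < T.+1)%N -> x t = \sum_(0 <= j < t.+1) cell Phix t j *m xi j) ->
  (forall t, (t < T)%N -> u t = \sum_(0 <= j < t.+1) cell Phiu t j *m xi j) ->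
  xi 0%N = x0 -> (forall s, (0 < s <= T)%N -> forall i, `|xi s i 0| <= 1) ->
  traj_cost Qh Rh (T := T) x u <= sls_cost x0 Qh Rh Phix Phiu.
Proof.
move=> Rh_sqrt Phix_low Phiu_low xE uE xi0 xi1.
pose X := \mxcol_(j < T.+1) xi j.
have XE : \mxcol_(t < T.+1) x t = Phix *m X.
  by rewrite block_lower_mulmx //; apply: eq_mxcol => t; apply: xE.
(* u_T is unconstrained, but its weight vanishes. *)
have UE : Rh *m \mxcol_(t < T.+1) u t = Rh *m (Phiu *m X).
  apply/eqP; rewrite -subr_eq0 -mulmxBr block_lower_mulmx //; apply/eqP.
  apply: psd_sqrt_ker Rh_sqrt _; rewrite -mxcolB mul_mxdiag_mxcol -[RHS]mxcol0.
  apply: eq_mxcol => t; case: eqP => [_|/eqP tT]; first by rewrite mul0mx.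
  by rewrite uE ?subrr ?mulmx0 // ltn_neqAle tT -ltnS ltn_ord.
rewrite /traj_cost /sls_cost mul_block_col !mul0mx addr0 add0r XE UE.
have -> : col_mx (Qh *m (Phix *m X)) (Rh *m (Phiu *m X)) =
    block_mx Qh 0 0 Rh *m col_mx (bcol0 Phix) (bcol0 Phiu) *m x0 +
    block_mx Qh 0 0 Rh *m col_mx (bcol1T Phix) (bcol1T Phiu) *m \mxcol_(j < T) xi j.+1.
  rewrite -!mulmxA -mulmxDr (mul_col_mx (bcol0 _)) (mul_col_mx (bcol1T _)) add_col_mx.
  rewrite -xi0 -!stacked_mulmx_bcol.
  by rewrite mul_block_col !mul0mx addr0 add0r.
apply: le_trans (ler_mx_norm_add _ _) _.
rewrite lerD2l; apply: ler_linf_induced_norm; apply: linf_norm_ler => // i.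
by rewrite mxE; apply: xi1; rewrite ltn_ord.
Qed.

Theorem corollary2 (R : realType) (T nx nu : nat) (T_ge1 : (1 <= T)%N)
    (Ahat : 'M[R]_nx) (Bhat : 'M[R]_(nx, nu))
    (M : nat) (M_ge1 : (1 <= M)%N)
    (DA : 'I_M -> 'M[R]_nx) (DB : 'I_M -> 'M[R]_(nx, nu))
    (W : set 'cV[R]_nx) (W_polytope : polytope W) (W_neq0 : W !=set0)
    (mx mu mT : nat)
    (Fx : 'M[R]_(mx, nx)) (bx : 'cV[R]_mx)
    (Fu : 'M[R]_(mu, nu)) (bu : 'cV[R]_mu)
    (FT : 'M[R]_(mT, nx)) (bT : 'cV[R]_mT)
    (X_compact : compact (polyhedron Fx bx))
    (X_int0 : interior (polyhedron Fx bx) 0)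
    (U_compact : compact (polyhedron Fu bu))
    (U_int0 : interior (polyhedron Fu bu) 0)
    (XT_compact : compact (polyhedron FT bT))
    (XT_int0 : interior (polyhedron FT bT) 0)
    (Q Q_T : 'M[R]_nx) (Ru : 'M[R]_nu)
    (Q_psd : psd Q) (Q_T_psd : psd Q_T) (Ru_posdef : posdef Ru)
    (Qh : 'M[R]_(stacked_dim T nx)) (Rh : 'M[R]_(stacked_dim T nu))
    (Qh_sqrt : is_psd_sqrt Qh (blkdiag_last T Q Q_T))
    (Rh_sqrt : is_psd_sqrt Rh (blkdiag_last T Ru 0))
    (x0 : 'cV[R]_nx) :
  (robust_ocp_value x0 Ahat Bhat Qh Rh
     (conv_hull (fun j : 'I_M => (DA j, DB j) : 'M[R]_nx * 'M[R]_(nx, nu))) W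
     (polyhedron Fx bx) (polyhedron Fu bu) (polyhedron FT bT)
   <= sls_value x0 Ahat Bhat Qh Rh DA DB W Fx bx Fu bu FT bT)%E.
Proof.
set P := conv_hull _.
(* Each feasible point of (P) must yield a feasible policy of no larger worst-case cost; if there is
   none, the infimum is +oo. *)
apply: le_ereal_inf_tmp => _ [[Phix Phiu] /= [Sigma [d feas]] <-].
(* The horizon here is [T.+1], so that x_T too is represented through [xi]. *)
have [K Kxi] := realizing_gains (cell Phiu) (cell_Phix_unit feas).
have xiE x u : admissible_traj T x0 Ahat Bhat P W K x u ->
  exists xi : nat -> 'cV[R]_nx,
    [/\ forall t, (t < T.+1)%N -> x t = \sum_(0 <= j < t.+1) cell Phix t j *m xi j,
        forall t, (t < T)%N -> u t = \sum_(0 <= j < t.+1) cell Phiu t j *m xi j,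
        xi 0%N = x0 & forall s, (0 < s <= T)%N -> forall i, `|xi s i 0| <= 1].
  move=> [D [w [PD Ww [x_0 uK xS]]]]; have [xi xiP] := Kxi x; exists xi.
  have xE t : (t < T.+1)%N -> x t = \sum_(0 <= j < t.+1) cell Phix t j *m xi j.
    by move=> /xiP[].
  have uE t : (t < T)%N -> u t = \sum_(0 <= j < t.+1) cell Phiu t j *m xi j.
    by move=> tT; rewrite uK //; case: (xiP t (ltnW tT)).
  by have [] := surrogate_disturbance_le1 W_polytope feas PD Ww x_0 xS xE uE.
(* First robust feasibility of [K], by (c)-(e); then the bound on its cost, trajectory by
   trajectory. *)
apply: ge_ereal_inf; exists (worst_case_cost x0 Ahat Bhat Qh Rh P W K).
  exists K => // x u /xiE[xi [xE uE xi0 xi1]]; have xi1_le t s :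
      (t <= T)%N -> (0 < s <= t)%N -> forall i, `|xi s i 0| <= 1.
    by move=> tT /andP[s0 st]; apply: xi1; rewrite s0 (leq_trans st).
  have rowE n k (F : 'M[R]_(k, n)) (v : 'cV[R]_n) i : (F *m v) i 0 = (row i F *m v) 0 0.
    by rewrite -row_mul [RHS]mxE.
  split=> [t tT|]; first split=> i.
  - rewrite rowE xE ?ltnS 1?ltnW //; apply: le_trans (sls_state feas i tT).
    exact: tightened_ge (xi1_le _ ^~ (ltnW tT)).
  - rewrite rowE uE //; apply: le_trans (sls_input feas i tT).
    exact: tightened_ge (xi1_le _ ^~ (ltnW tT)).
  - move=> i; rewrite rowE xE //; apply: le_trans (sls_terminal feas i).
    exact: tightened_ge xi1.
apply: ge_ereal_sup => _ [[x u] /= /xiE[xi [xE uE xi0 xi1]] <-].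
rewrite lee_fin; apply: traj_cost_le_sls_cost xE uE xi0 xi1 => //; first exact: Rh_sqrt.
- exact: sls_Phix_lower feas.
- exact: sls_Phiu_lower feas.
Qed.
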